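(* For every integer $n\ge 0$, the number of primitive PPP's with semi-perimeter $n+2$ is $\displaystyle \frac{(2n+1)!}{n!^2}$. The generating series of primitive PPP's according to the semi-perimeter $sp$ is $$\sum_{P\ \text{primitive PPP}} z^{sp(P)} = z^2(1-4z)^{-3/2}.$$
   Context: **PPP's.** A parallelogram polyomino is a finite set of unit cells of $\mathbb Z\times\mathbb Z$, defined up to translation, consisting of all cells contained between two lattice paths with unit North ($N$) and East ($E$) steps that intersect only at their common starting and ending points (the upper path and the lower path). Columns are ordered from left (first) to right (last). A periodic parallelogram polyomino (PPP) is a parallelogram polyomino $P$ together with a positive integer $g$, the gluing size, which is at most the minimum of the heights of the first and last columns of $P$; one excludes the PPP's of rectangular shape whose gluing size equals the height of the columns. The PPP is viewed on a cylinder: if $P$ has $H$ rows numbered from bottom to top, the $g$ top cells of the last column are glued to the $g$ bottom cells of the first column, so that row $H-g+i$ is continued on its right by row $i$ for $1\le i\le g$. Rows glued together count as the same row. The width is the number of columns, the height is the number of rows after gluing, i.e. $H-g$, and the semi-perimeter is the sum of the height and the width. **Trunk and intrinsic thickness.** The vertices of a PPP $P$ are the top cells of its columns (column vertices) and the rightmost cells of its rows (row vertices; each glued row has one rightmost cell, found by following the row to the right through the gluing). The parent of a column vertex is the row vertex of the row containing it; the parent of a row vertex is the column vertex of the column containing it. Joining each vertex to its parent gives a graph each of whose connected components has exactly one cycle (possibly of length $2$). Its leaves correspond to the columns or rows of $P$ containing only one vertex. A trunk PPP is a PPP whose graph is a disjoint union of cycles; these are the PPP's with upper path $N^k(NE)^l$,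 lower path $(EN)^lN^k$ and gluing size $k$, with $k,l$ positive integers (such a trunk PPP has width $l$). Recursively removing from $P$ the rows and columns corresponding to leaves (on the cylinder, so that the gluing size after each removal is the number of rows of the remaining polyomino before gluing minus the number of remaining rows after gluing), one obtains a trunk PPP denoted $trunk(P)$. The intrinsic thickness of $P$ is the gluing size of $trunk(P)$. **Primitive.** A PPP $P$ is primitive if and only if its intrinsic thickness is less than or equal to the width of $trunk(P)$. *)

(* Defs.v *)
From HB Require Import structures.
From mathcomp Require Import all_boot all_order all_algebra.
From mathcomp Require Import finmap boolp classical_sets functions cardinality fsbigop.
From Stdlib Require Import Relation_Operators.

Set Implicit Arguments.
Unset Strict Implicit.
Unset Printing Implicit Defensive.

Import GRing.Theory.
Local Open Scope nat_scope.

(** A lattice path from the origin is a word of steps: [true] is a North step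
    and [false] is an East step. *)
Definition lpath := seq bool.

Definition norths (p : lpath) : nat := count id p.
Definition easts (p : lpath) : nat := count negb p.

Fixpoint east_heights_from (h : nat) (p : lpath) : seq nat :=
  match p with
  | [::] => [::]
  | true :: q => east_heights_from h.+1 q
  | false :: q => h :: east_heights_from h q
  end.

(** Ordinate of the East step of [p] above (or below) column [i]. *)
Definition east_height (p : lpath) (i : nat) : nat :=
  nth 0 (east_heights_from 0 p) i.

(** [u] is the upper path and [d] the lower path.  A vertex common to two paths
    with the same origin is reached by both after the same number of steps, so
    comparing prefixes of equal length says that the paths meet only at their
    ends and that [u] is the upper one.  Since both paths start at the origin,
    such a pair is a parallelogram polyomino up to translation. *)
Definition parallelogram (u d : lpath) : bool :=
  [&& 1 < size u, size u == size d, norths u == norths d &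
      all (fun k => norths (take k d) < norths (take k u))
          (iota 1 (size u).-1)].

Definition column_height (u d : lpath) (i : nat) : nat :=
  east_height u i - east_height d i.

Definition rectangle (u d : lpath) : bool :=
  (u == nseq (norths u) true ++ nseq (easts u) false) &&
  (d == nseq (easts u) false ++ nseq (norths u) true).

Definition is_ppp (x : lpath * lpath * nat) : bool :=
  let: (u, d, g) := x in
  [&& parallelogram u d, 0 < g,
      g <= minn (column_height u d 0) (column_height u d (easts u).-1) &
      ~~ (rectangle u d && (g == norths u))].

Record ppp := PPP { ppp_val : lpath * lpath * nat; _ : is_ppp ppp_val }.
HB.instance Definition _ := [isSub for ppp_val].
HB.instance Definition _ := [Choice of ppp by <:].

Definition upper (P : ppp) : lpath := (ppp_val P).1.1.
Definition lower (P : ppp) : lpath := (ppp_val P).1.2.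
Definition gluing (P : ppp) : nat := (ppp_val P).2.

Definition width (P : ppp) : nat := easts (upper P).
(** Number of rows before gluing. *)
Definition rows (P : ppp) : nat := norths (upper P).
(** Number of rows after gluing. *)
Definition height (P : ppp) : nat := rows P - gluing P.
Definition semiperimeter (P : ppp) : nat := height P + width P.

(** Rows and columns are numbered from 0: [cell P i j] says that the unit cell
    in column [i] and row [j] (before gluing) belongs to [P].  It is false for
    [i >= width P], both ordinates being then 0. *)
Definition cell (P : ppp) (i j : nat) : bool :=
  east_height (lower P) i <= j < east_height (upper P) i.

(** Row [height P + j] is continued on its right by row [j], so the rows after
    gluing are the classes modulo [height P] of the rows before gluing.  The
    last piece of a glued row is the one whose index is less than [height P]. *)
Definition glued_row (P : ppp) (j : nat) : nat := j %% height P.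

Definition column_vertex (P : ppp) (i : nat) : nat * nat :=
  (i, (east_height (upper P) i).-1).

Definition row_vertex (P : ppp) (j : nat) : nat * nat :=
  (\max_(i < width P | cell P i j) i, j).

Definition vertices (P : ppp) : seq (nat * nat) :=
  [seq column_vertex P i | i <- iota 0 (width P)] ++
  [seq row_vertex P j | j <- iota 0 (height P)].

(** A vertex is either the top of its column or a row vertex, never both: the
    top cell of a column has a right neighbour in its (glued) row. *)
Definition parent (P : ppp) (v : nat * nat) : nat * nat :=
  if v == column_vertex P v.1 then row_vertex P (glued_row P v.2)
  else column_vertex P v.1.

Definition column_leaf (P : ppp) (i : nat) : bool :=
  count (fun v => v.1 == i) (vertices P) == 1.

Definition row_leaf (P : ppp) (j : nat) : bool :=
  count (fun v => glued_row P v.2 == j) (vertices P) == 1.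

(** The graph joins each vertex to its parent; being functional, it is a
    disjoint union of cycles when every vertex lies on a cycle of [parent]. *)
Definition is_trunk (P : ppp) : Prop :=
  {in vertices P, forall v, exists2 c, fcycle (parent P) c & v \in c}.

(** [Q] is [P] with column [i] removed; [bump i] skips [i]. *)
Definition remove_column (P : ppp) (i : nat) (Q : ppp) : Prop :=
  [/\ column_leaf P i,
      forall i' j, cell Q i' j = cell P (bump i i') j &
      gluing Q = rows Q - height P].

(** [Q] is [P] with the glued row [r] removed: the remaining rows [j] are
    renumbered by the number of remaining rows below them. *)
Definition remove_row (P : ppp) (r : nat) (Q : ppp) : Prop :=
  [/\ row_leaf P r,
      forall i j, glued_row P j != r ->
        cell Q i (count (fun k => glued_row P k != r) (iota 0 j)) = cell P i j &
      gluing Q = rows Q - (height P).-1].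

Definition leaf_removal (P Q : ppp) : Prop :=
  (exists i, remove_column P i Q) \/ (exists r, remove_row P r Q).

Definition trunk_of (P T : ppp) : Prop :=
  clos_refl_trans ppp leaf_removal P T /\ is_trunk T.

(** The trunk [T] is unique, and [gluing T] is the intrinsic thickness of [P]. *)
Definition primitive (P : ppp) : Prop :=
  exists2 T, trunk_of P T & gluing T <= width T.

Definition primitive_ppps : set ppp := [set P | primitive P]%classic.

Definition primitive_ppps_of (s : nat) : set ppp :=
  [set P | primitive P /\ semiperimeter P = s]%classic.

(** Formal power series in [z] with rational coefficients, given by their
    coefficient sequences. *)
Local Open Scope ring_scope.

Definition fps := nat -> rat.

Definition fps_z : fps := fun m => (m == 1%N)%:R.

Definition fps_scale (c : rat) (a : fps) : fps := fun m => c * a m.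

Definition fps_mul (a b : fps) : fps :=
  fun m => \sum_(i < m.+1) a i * b (m - i)%N.

Definition fps_exp (a : fps) (k : nat) : fps :=
  iter k (fps_mul a) (fun m => (m == 0%N)%:R).

Definition gbinom (alpha : rat) (k : nat) : rat :=
  (\prod_(i < k) (alpha - i%:R)) / k`!%:R.

(** Newton's series [(1 + a)^alpha = \sum_k gbinom alpha k * a^k], for [a]
    without constant term; then [a^k] has no term of degree less than [k], so
    the sum below is the whole coefficient. *)
Definition fps_1Dpow (a : fps) (alpha : rat) : fps :=
  fun m => \sum_(k < m.+1) gbinom alpha k * fps_exp a k m.

(** The series [\sum_P z^(semiperimeter P)] over the primitive PPP's, summed
    coefficientwise. *)
Definition primitive_series : fps :=
  fun m => \sum_(P \in primitive_ppps) fps_exp fps_z (semiperimeter P) m.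

(* Main.v *)
Require Import Defs.
From mathcomp Require Import all_boot all_order all_algebra.
From mathcomp Require Import finmap boolp classical_sets functions cardinality fsbigop.
From mathcomp Require Import zify ring.
From Stdlib Require Import Relation_Operators.

(** A PPP of width [W] and height [h] is, once unrolled, a strip of the plane
    invariant under the translation by [(W, h)] and bounded by two periodic
    paths. Apply the parent map twice to a column [c] of the strip: go up to the
    top of [c], then follow the row of this top to the right until it ends, say
    in column [phi c]. The map [phi] is nondecreasing and commutes with the
    translation by [W]. The two boundaries are disjoint exactly when
    [phi c > c] for all [c].

    Such a map has a rotation number, here the mean number of turns around the
    cylinder per step, which can be read on any cycle of the graph. Removing
    leaves keeps the cycles, hence the rotation number. In a trunk of gluing
    size [k] and width [l] we have [phi c = c + k], so the rotation number is
    [k / l]. Hence a PPP is primitive exactly when its rotation number is at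
    most 1, that is, when [phi c <= c + W] for some [c]. This is the property
    [winds_once]. The inequality is transported directly through the removal of a
    leaf column ([remove_column_winds_once]) and of a leaf row
    ([remove_row_winds_once]), and compared with the thickness on the PPP's
    without leaves, which are the trunks ([primitiveE]).

    Now fix the two boundaries up to a vertical translation and let the gluing
    size [g] vary. When [g] decreases by [h], the map [phi] decreases by [W], so
    [winds_once] says that the boundaries would meet with the gluing size
    [g - h]. Disjointness is a condition [m < g], where [m] is the [overlap] of
    the boundaries, so the primitive PPP's correspond to [m < g <= m + h]: there
    are exactly [h] of them. The boundaries of a PPP of semi-perimeter [n + 2]
    are given by two arbitrary words of length [n + 1] with [h] North steps
    each, and the number of primitive PPP's is the sum over [h] of
    [h * 'C(n + 1, h) ^ 2]. Vandermonde's identity turns it into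
    [(n + 1) * 'C(2 * n + 1, n)] ([card_word_pairs]), which is the announced
    value and also the coefficient given by Newton's series
    ([gbinom_m3half]). *)

Set Implicit Arguments.
Unset Strict Implicit.
Unset Printing Implicit Defensive.

Local Open Scope nat_scope.

(** * Lattice paths and heights of East steps *)

Lemma norths_cat p q : norths (p ++ q) = norths p + norths q.
Proof. exact: count_cat. Qed.

Lemma easts_cat p q : easts (p ++ q) = easts p + easts q.
Proof. exact: count_cat. Qed.

Lemma northsDeasts p : norths p + easts p = size p.
Proof. exact: (count_predC id p). Qed.

Lemma norths_nseq n x : norths (nseq n x) = x * n.
Proof. by rewrite /norths count_nseq; case: x. Qed.

Lemma easts_nseq n x : easts (nseq n x) = ~~ x * n.
Proof. by rewrite /easts count_nseq. Qed.

Lemma east_heights_fromD h p :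
  east_heights_from h p = [seq h + x | x <- east_heights_from 0 p].
Proof.
elim: p h => [|[] p IH] h //=; first rewrite IH [RHS]/= (IH 1) -map_comp.
  by apply: eq_map => x /=; rewrite addnA addn1.
by rewrite addn0 [in LHS]IH.
Qed.

Lemma east_heights_from_cat h p q :
  east_heights_from h (p ++ q) =
  east_heights_from h p ++ east_heights_from (h + norths p) q.
Proof.
elim: p h => [|[] p IH] h /=; first by rewrite addn0.
  by rewrite IH addSnnS.
by rewrite IH.
Qed.

Lemma size_east_heights_from h p : size (east_heights_from h p) = easts p.
Proof. by elim: p h => [|[] p IH] h //=; rewrite IH. Qed.

Lemma east_height_north p i :
  i < easts p -> east_height (true :: p) i = (east_height p i).+1.
Proof.
move=> lt_i; rewrite /east_height /= (east_heights_fromD 1).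
by rewrite (nth_map 0) ?size_east_heights_from.
Qed.

Lemma east_height_east p i :
  east_height (false :: p) i = if i is j.+1 then east_height p j else 0.
Proof. by case: i. Qed.

Lemma east_height_le_norths p i : east_height p i <= norths p.
Proof.
have [lt_i|le_i] := ltnP i (easts p); last first.
  by rewrite /east_height nth_default ?size_east_heights_from.
elim: p i lt_i => [|[] p IH] [|i] //=.
- by move=> lt_i; rewrite east_height_north //= ltnS IH.
- by move=> lt_i; rewrite east_height_north //= ltnS IH.
- exact: IH.
Qed.

Lemma east_height_homo p i j :
  i <= j < easts p -> east_height p i <= east_height p j.
Proof.
elim: p i j => [|[] p IH] i j //=; first by rewrite andbC.
- move=> ij; rewrite !east_height_north ?ltnS ?IH //.
  + by case/andP: ij.
  + by case/andP: ij; apply: leq_ltn_trans.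
- rewrite !east_height_east; case: i j => [|i] [|j] //=.
  exact: IH.
Qed.

(** The East step number [i] is the step number [east_height p i + i] of [p];
    so prefixes can be compared through the heights of the East steps. *)
Lemma easts_take_le p k i : i < easts p ->
  (easts (take k p) <= i) = (k <= east_height p i + i).
Proof.
elim: p k i => [|[] p IH] [|k] i //= lt_i.
- by rewrite east_height_north // add0n IH // addSn ltnS.
- rewrite east_height_east; case: i lt_i => [|i] lt_i //.
  by rewrite add1n ltnS IH // addnS ltnS.
Qed.

(** The North steps along which a PPP is glued, at the start of its upper path and
    at the end of its lower path, are recognized on the heights of the first and
    of the last East steps. *)
Lemma north_prefix g p : g <= east_height p 0 -> exists q, p = nseq g true ++ q.
Proof.
elim: g p => [|g IH] p; first by exists p.
case: p => [|[] p] //; have [lt0|] := posnP (easts p).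
  rewrite /east_height /= nth_default //.
  by rewrite size_east_heights_from lt0.
by move=> /east_height_north-> /IH[q ->]; exists q.
Qed.

Lemma north_suffix g p : 0 < easts p ->
  east_height p (easts p).-1 + g <= norths p -> exists q, p = q ++ nseq g true.
Proof.
elim: g p => [|g IH] p; first by exists p; rewrite cats0.
case/lastP: p => [|p x] //; rewrite -cats1 norths_cat easts_cat /east_height.
rewrite east_heights_from_cat nth_cat size_east_heights_from.
case: x => /=; rewrite ?addn0 ?addn1 => W_gt0.
  rewrite prednK // leqnn addnS ltnS => /(IH _ W_gt0)[q ->].
  by exists q; rewrite -catA -(nseqD g 1) addn1.
by rewrite ltnn subnn /=; lia.
Qed.

Lemma norths0 p : norths p = 0 -> p = nseq (easts p) false.
Proof. by elim: p => [|[] p IH] //= /IH->; rewrite easts_nseq mul1n. Qed.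

(** Two paths with the same ends meet nowhere else exactly when consecutive
    columns share an edge, the bottom of the right one being lower than the top
    of the left one. Gluing along all the rows forces a rectangle, hence the
    strict inequality [g < norths u]. *)
Lemma is_pppP u d g : size u = size d -> norths u = norths d ->
  reflect
    [/\ 0 < easts u,
        east_height d 0 = 0 /\ east_height u (easts u).-1 = norths u,
        forall i, i.+1 < easts u -> east_height d i.+1 < east_height u i,
        0 < g < norths u &
        g <= east_height u 0 /\ east_height d (easts u).-1 + g <= norths u]
    (is_ppp (u, d, g)).
Proof.
move=> sz_ud nn_ud.
have ee_ud : easts u = easts d.
  by have := northsDeasts u; have := northsDeasts d; lia.
have take_lt k : k <= size u -> (norths (take k d) < norths (take k u)) =
    (easts (take k u) < easts (take k d)).
  move=> le_k; have := northsDeasts (take k u); have := northsDeasts (take k d).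
  by rewrite !size_takel -?sz_ud //; lia.
have szu := northsDeasts u.
rewrite /is_ppp /parallelogram /column_height sz_ud nn_ud !eqxx /= -sz_ud.
apply: (iffP idP).
- case/and4P=> /andP[sz_gt1 /allP pre] g_gt0 le_g not_rect.
  have {}pre k : 0 < k < size u -> easts (take k u) < easts (take k d).
    move=> k_bd; rewrite -take_lt; last by lia.
    by apply: pre; rewrite mem_iota; lia.
  have W_gt0 : 0 < easts u.
    rewrite lt0n; apply/eqP=> W0; have := pre 1; rewrite sz_gt1 => /(_ isT).
    have : easts (take 1 d) <= easts d.
      by rewrite -{2}(cat_take_drop 1 d) easts_cat leq_addr.
    lia.
  have d0 : east_height d 0 = 0.
    have := pre 1; rewrite sz_gt1 => /(_ isT).
    by have := @easts_take_le d 1 0; rewrite -ee_ud => /(_ W_gt0); lia.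
  have uW : east_height u (easts u).-1 = norths u.
    have /pre : 0 < (size u).-1 < size u by lia.
    have := @easts_take_le u (size u).-1 (easts u).-1.
    have : easts (take (size u).-1 d) <= easts d.
      by rewrite -{2}(cat_take_drop (size u).-1 d) easts_cat leq_addr.
    have := east_height_le_norths u (easts u).-1.
    lia.
  (* The prefix of [u] that ends with its East step number [i]. *)
  have ud i : i.+1 < easts u -> east_height d i.+1 < east_height u i.
    move=> lt_i; have := east_height_le_norths u i.
    have := pre (east_height u i + i).+1.
    have := @easts_take_le u (east_height u i + i).+1 i.
    have := @easts_take_le d (east_height u i + i).+1 i.+1.
    lia.
  have le_g0 : g <= east_height u 0 by lia.
  have le_gW : east_height d (easts u).-1 + g <= norths u by lia.
  suff neq_gH : g != norths u by split=> //; lia.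
  apply: contraNneq not_rect => gH.
  have [u' Eu] := north_prefix le_g0.
  have [d' Ed] : exists q, d = q ++ nseq g true.
    by apply: north_suffix; rewrite -?ee_ud -?nn_ud // gH.
  have /norths0 Eu' : norths u' = 0.
    by move: gH; rewrite Eu norths_cat norths_nseq; lia.
  have /norths0 Ed' : norths d' = 0.
    by move: gH; rewrite nn_ud Ed norths_cat norths_nseq; lia.
  have eu' : easts u = easts u' by rewrite Eu easts_cat easts_nseq.
  have ed' : easts u = easts d' by rewrite ee_ud Ed easts_cat easts_nseq addn0.
  rewrite -nn_ud gH eqxx andbT /rectangle -gH; apply/andP; split; apply/eqP.
    by rewrite eu' -Eu'.
  by rewrite ed' -Ed'.
- case=> W_gt0 [d0 uW] ud /andP[g_gt0 g_lt] [le_g0 le_gW].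
  apply/and4P; split=> //.
  + apply/andP; split; first by lia.
    apply/allP=> k; rewrite mem_iota => k_bd; rewrite take_lt; last by lia.
    have [ltW|geW] := ltnP (easts (take k u)) (easts u); last first.
      have := @easts_take_le u k (easts u).-1; lia.
    have := @easts_take_le d k (easts (take k u)); rewrite -ee_ud => /(_ ltW).
    case E: (easts (take k u)) => [|e]; first by lia.
    have := @easts_take_le u k e; have := ud e; lia.
  + by lia.
  + apply/negP=> /andP[_ /eqP]; lia.
Qed.

(** * The boundaries of a PPP *)

Definition top (P : ppp) (i : nat) : nat := east_height (upper P) i.

(** The lower boundary continued by one column: to the right of the last
    column it is the bottom of the first column again, [height P] rows up. *)
Definition bottom (P : ppp) (i : nat) : nat :=
  if i < width P then east_height (lower P) i else height P.

Lemma path_norths_easts (P : ppp) :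
  size (upper P) = size (lower P) /\ norths (upper P) = norths (lower P).
Proof.
case: P => [[[u d] g] /=]; rewrite /upper /lower /=.
by case/and4P=> /and4P[_ /eqP-> /eqP->].
Qed.

Lemma easts_lower P : easts (lower P) = width P.
Proof.
have [] := path_norths_easts P; rewrite /width.
by have := northsDeasts (upper P); have := northsDeasts (lower P); lia.
Qed.

Lemma ppp_path_spec P :
    [/\ 0 < width P,
        east_height (lower P) 0 = 0 /\ top P (width P).-1 = rows P,
        forall i, i.+1 < width P -> east_height (lower P) i.+1 < top P i,
        0 < gluing P < rows P &
        gluing P <= top P 0 /\
        east_height (lower P) (width P).-1 + gluing P <= rows P].
Proof.
have [] := path_norths_easts P; rewrite /top /rows /width.
by case: P => [[[u d] g] /= P_ppp] sz nn; apply/(is_pppP _ sz nn).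
Qed.

Lemma width_gt0 P : 0 < width P. Proof. by case: (ppp_path_spec P). Qed.
Lemma gluing_gt0 P : 0 < gluing P.
Proof. by case: (ppp_path_spec P) => _ _ _ /andP[]. Qed.
Lemma height_gt0 P : 0 < height P.
Proof. by case: (ppp_path_spec P) => _ _ _ /andP[_]; rewrite /height; lia. Qed.
Lemma rowsE P : rows P = gluing P + height P.
Proof. by case: (ppp_path_spec P) => _ _ _ /andP[_]; rewrite /height; lia. Qed.

Lemma top_last P : top P (width P).-1 = rows P.
Proof. by case: (ppp_path_spec P) => _ []. Qed.
Lemma gluing_le_top P : gluing P <= top P 0.
Proof. by case: (ppp_path_spec P) => _ _ _ _ []. Qed.
Lemma bottom0 P : bottom P 0 = 0.
Proof. by case: (ppp_path_spec P) => W_gt0 [d0 _]; rewrite /bottom W_gt0. Qed.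
Lemma bottom_width P : bottom P (width P) = height P.
Proof. by rewrite /bottom ltnn. Qed.

Lemma top_homo P i j : i <= j < width P -> top P i <= top P j.
Proof. exact: east_height_homo. Qed.

Lemma bottom_homo P i j : i <= j -> bottom P i <= bottom P j.
Proof.
move=> le_ij; rewrite /bottom; case: (ltnP i) => lt_i; last first.
  by rewrite ltnNge (leq_trans lt_i).
case: (ltnP j) => [lt_j|_]; first by apply: east_height_homo; rewrite le_ij easts_lower.
have [W_gt0 _ _ g_bd [_]] := ppp_path_spec P; rewrite /height.
have : east_height (lower P) i <= east_height (lower P) (width P).-1.
  by apply: east_height_homo; rewrite easts_lower; lia.
lia.
Qed.

Lemma bottom_lt_top P i : i < width P -> bottom P i.+1 < top P i.
Proof.
move=> lt_i; rewrite /bottom; case: (ltnP i.+1 (width P)) => [lt_i1 | ge_i1].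
  by have [_ _ /(_ i lt_i1)] := ppp_path_spec P.
have -> : i = (width P).-1 by lia.
by rewrite top_last rowsE; have := gluing_gt0 P; lia.
Qed.

Lemma cellE P i j : cell P i j = (i < width P) && (bottom P i <= j < top P i).
Proof.
rewrite /cell /bottom /top; case: (ltnP i (width P)) => //= ge_i.
rewrite [in X in _ < X]/east_height nth_default ?ltn0 ?andbF //.
by rewrite size_east_heights_from.
Qed.

Lemma leq_interval_eq a b a' b' : a < b ->
  (forall m, (a <= m < b) = (a' <= m < b')) -> a = a' /\ b = b'.
Proof.
move=> lt_ab E; have := E a; have := E b.-1; have := E a'; have := E b'.-1.
lia.
Qed.

(** The columns are nonempty intervals of cells, so cells give back heights; the
    removals of leaves are specified on cells and computed on heights. *)
Lemma ppp_of_cells P W a b : (forall i, i < W -> b i < a i) ->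
  (forall i j, cell P i j = (i < W) && (b i <= j < a i)) ->
  [/\ width P = W, forall i, i < W -> top P i = a i &
      forall i, i < W -> bottom P i = b i].
Proof.
move=> lt_ba cellP.
have bt i : i < width P -> bottom P i < top P i.
  by move=> lt_i; have := bottom_lt_top lt_i; have := @bottom_homo P i i.+1; lia.
have WP : width P = W.
  have := cellP (width P) (b (width P)); have := cellP W (bottom P W).
  rewrite !cellE !ltnn !leqnn /=; have := bt W; have := lt_ba (width P).
  by lia.
have ab i : i < W -> bottom P i = b i /\ top P i = a i.
  move=> lt_i; apply: leq_interval_eq => [|m]; first by apply: bt; rewrite WP.
  by have := cellP i m; rewrite cellE WP lt_i.
by split=> // i /ab[].
Qed.

Lemma east_heights_from_nseq n h : east_heights_from h (nseq n true) = [::].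
Proof. by elim: n h => //= n IH h; rewrite IH. Qed.

Fixpoint path_of_heights (h H : nat) (hs : seq nat) : lpath :=
  if hs is x :: hs' then nseq (x - h) true ++ false :: path_of_heights x H hs'
  else nseq (H - h) true.

Lemma path_of_heightsK h H hs : path leq h hs -> last h hs <= H ->
  east_heights_from h (path_of_heights h H hs) = hs /\
  norths (path_of_heights h H hs) = H - h.
Proof.
elim: hs h => [|x hs IH] h /= => [_ le_h|/andP[le_hx le_hs] le_H].
  split; last by rewrite norths_nseq mul1n.
  exact: east_heights_from_nseq.
have [E N] := IH x le_hs le_H.
rewrite east_heights_from_cat norths_cat norths_nseq mul1n subnKC //=.
rewrite east_heights_from_nseq E /=.
split=> //; rewrite -/(norths _) N.
suff : x <= last x hs by lia.
by elim: hs x le_hs {IH le_hx le_H E N} => //= y hs IH x /andP[xy /IH]; lia.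
Qed.

Lemma exists_path W H (a : nat -> nat) :
    (forall i j, i <= j < W -> a i <= a j) -> (forall i, i < W -> a i <= H) ->
  exists p, [/\ easts p = W, norths p = H & forall i, i < W -> east_height p i = a i].
Proof.
move=> a_homo a_le; exists (path_of_heights 0 H (mkseq a W)).
have [E N] : east_heights_from 0 (path_of_heights 0 H (mkseq a W)) = mkseq a W /\
  norths (path_of_heights 0 H (mkseq a W)) = H - 0.
  apply: path_of_heightsK.
    apply/(pathP 0) => i; rewrite size_mkseq => lt_i.
    rewrite nth_mkseq //; case: i lt_i => [//|i] lt_i.
    by rewrite /= nth_mkseq ?a_homo //; lia.
  case: W {a_homo} a_le => // W a_le.
  by rewrite (last_nth 0) size_mkseq [nth _ _ _]/= nth_mkseq ?a_le.
split; first by rewrite -(size_east_heights_from 0) E size_mkseq.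
  by rewrite N subn0.
by move=> i lt_i; rewrite /east_height E nth_mkseq.
Qed.

(** A converse to the properties of [top] and [bottom] above. The heights of the
    two boundaries of the strip are constrained only by monotonicity,
    periodicity and disjointness; [g <= a 0] is the monotonicity of the tops
    across the gluing, and [0 < g] follows from the last hypothesis at the last
    column. *)
Lemma exists_ppp W h g (a b : nat -> nat) : 0 < W -> 0 < h ->
    (forall i j, i <= j < W -> a i <= a j) ->
    (forall i j, i <= j <= W -> b i <= b j) ->
    b 0 = 0 -> b W = h -> a W.-1 = g + h -> g <= a 0 ->
    (forall i, i < W -> b i.+1 < a i) ->
  exists P, [/\ width P = W, height P = h, gluing P = g,
    forall i, i < W -> top P i = a i & forall i, i <= W -> bottom P i = b i].
Proof.
move=> W_gt0 h_gt0 a_homo b_homo b0 bW aW le_g lt_ba.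
have [i lt_i|u [uW uH uE]] := exists_path (W := W) (H := g + h) a_homo.
  by rewrite -aW; apply: a_homo; lia.
have [i j ij|i lt_i|d [dW dH dE]] := exists_path (W := W) (H := g + h) (a := b).
- by apply: b_homo; lia.
- by apply: leq_trans (leq_addl _ _); rewrite -bW b_homo //; lia.
have g_gt0 : 0 < g by have := lt_ba W.-1; rewrite prednK // bW aW; lia.
have P_ppp : is_ppp (u, d, g).
  apply/is_pppP; rewrite ?uW ?uH ?dH //.
    by rewrite -!northsDeasts uW uH dW dH.
  split=> //.
  - by rewrite dE // uE //; lia.
  - by move=> i lt_i; rewrite dE // uE; last lia; apply: lt_ba; lia.
  - by rewrite g_gt0; lia.
  - rewrite uE // dE; last lia; split=> //.
    by rewrite addnC leq_add2l -bW b_homo //; lia.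
exists (PPP P_ppp).
have hE : height (PPP P_ppp) = h by rewrite /height /rows /gluing /upper /= uH; lia.
have WE : width (PPP P_ppp) = W by [].
split=> // i le_i.
rewrite /bottom WE; case: (ltnP i W) => [/dE //|ge_i].
by rewrite hE -bW; congr b; lia.
Qed.

(** * Leaves *)

(** The lower boundary rises along the right side of column [c] exactly through
    the rows that end in [c]. *)
Lemma row_vertexE P c j : c < width P -> bottom P c <= j < bottom P c.+1 ->
  row_vertex P j = (c, j).
Proof.
move=> lt_c c_j; congr (_, _); apply/eqP; rewrite eqn_leq; apply/andP; split.
  apply/bigmax_leqP=> i; rewrite cellE => /and3P[_ le_ij _].
  rewrite -ltnS ltnNge; apply/negP=> /(@bottom_homo P); lia.
apply: (@leq_bigmax_cond _ (fun i : 'I_(width P) => cell P i j) id (Ordinal lt_c)).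
by rewrite cellE lt_c /=; have := bottom_lt_top lt_c; lia.
Qed.

Lemma row_endP P j : j < height P ->
  exists2 c, c < width P & bottom P c <= j < bottom P c.+1.
Proof.
rewrite -bottom_width; elim: (width P) => [|n IH] lt_j; first by rewrite bottom0 in lt_j.
have [/IH[c]|ge_j] := ltnP j (bottom P n); last by exists n; rewrite ?ge_j.
by move=> lt_c c_j; exists c => //; apply: ltnW.
Qed.

Lemma glued_row_lt P j : glued_row P j < height P.
Proof. by rewrite ltn_mod height_gt0. Qed.

Lemma glued_row_small P j : j < height P -> glued_row P j = j.
Proof. exact: modn_small. Qed.

(** A column is a leaf when no row ends in it, so when the lower boundary does not
    rise on its right side. *)
Lemma column_leafE P i :
  column_leaf P i = (i < width P) && (bottom P i == bottom P i.+1).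
Proof.
rewrite /column_leaf /vertices count_cat !count_map.
rewrite (_ : count _ (iota 0 (width P)) = (i < width P)); last first.
  rewrite -[LHS]/(count_mem i (iota 0 (width P))) count_uniq_mem ?iota_uniq //.
  by rewrite mem_iota.
set n := count _ _.
have n_gt0 : (0 < n) = (i < width P) && (bottom P i < bottom P i.+1).
  rewrite -has_count; apply/hasP/andP=> [[j]|[lt_i lt_b]].
    rewrite mem_iota => /row_endP[c lt_c c_j] /=.
    have [-> /eqP<-] := row_vertexE lt_c c_j; split=> //; lia.
  have lt_h : bottom P i < height P.
    by apply: leq_trans lt_b _; rewrite -bottom_width; apply: bottom_homo.
  have /(row_vertexE lt_i)[Ei] : bottom P i <= bottom P i < bottom P i.+1.
    by rewrite leqnn.
  by exists (bottom P i); rewrite ?mem_iota //= Ei.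
have := @bottom_homo P i i.+1 (leqnSn i); move: n_gt0.
by case: (i < width P) => /=; lia.
Qed.

(** Every row contains one row vertex, its own, so the leaves among the rows are
    those that contain the top of no column. *)
Lemma row_leafE P r : row_leaf P r =
  (r < height P) && all (fun c => glued_row P (top P c).-1 != r) (iota 0 (width P)).
Proof.
rewrite /row_leaf /vertices count_cat !count_map.
rewrite (_ : count _ (iota 0 (height P)) = (r < height P)); last first.
  rewrite (@eq_in_count _ _ (pred1 r)) => [|j]; last first.
    by rewrite mem_iota /= => lt_j; rewrite glued_row_small.
  by rewrite count_uniq_mem ?iota_uniq // mem_iota.
rewrite -[all _ _]negbK -has_predC has_count.
rewrite (@eq_count _ (predC _) (fun c => glued_row P (top P c).-1 == r)); last first.
  by move=> c; rewrite -[RHS]negbK.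
rewrite [X in (X + _ == 1)](_ : _ =
  count (fun c => glued_row P (top P c).-1 == r) (iota 0 (width P))) //.
set n := count _ _; case: (ltnP r) => /= [_|le_r]; first by rewrite addn1 eqSS lt0n negbK.
rewrite addn0 (_ : n = 0) //; apply/eqP; rewrite -leqn0 leqNgt -has_count.
by apply/hasPn=> c _ /=; have := glued_row_lt P (top P c).-1; lia.
Qed.

(** The row of the top of some column [i] ends at or before the first return to
    column [i], one turn further. On the unrolled strip, this row ends in a
    column at most [i + width P] when it is below the bottom of the column
    [i + width P + 1], which is at height [bottom P i.+1 + height P]. *)
Definition winds_once P :=
  exists2 i, i < width P & top P i <= bottom P i.+1 + height P.

(** * Removal of a leaf column *)

Lemma remove_column_spec P i Q : remove_column P i Q ->
  [/\ width P = (width Q).+1, height Q = height P,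
      forall c, c < width Q -> top Q c = top P (bump i c) &
      forall c, c <= width Q -> bottom Q c = bottom P (bump i c)].
Proof.
rewrite /remove_column column_leafE => -[/andP[lt_i _] cellQ gQ].
have bt c : c < width P -> bottom P c < top P c.
  by move=> lt_c; have := bottom_lt_top lt_c; have := @bottom_homo P c c.+1; lia.
have := @ppp_of_cells Q (width P).-1 (top P \o bump i) (bottom P \o bump i).
case=> /= [c lt_c|c j|WQ topQ bottomQ].
- by apply: bt; rewrite /bump; lia.
- by rewrite cellQ cellE; congr (_ && _); rewrite /bump; lia.
have hQ : height Q = height P by have := gluing_gt0 Q; rewrite {1}/height; lia.
rewrite WQ; split=> //; first by lia.
move=> c; rewrite leq_eqVlt => /predU1P[->|/bottomQ//].
rewrite -{1}WQ bottom_width hQ -bottom_width; congr bottom.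
by rewrite /bump; lia.
Qed.

(** Only the comparison of the top of the leaf [i] with the bottom of its right
    neighbour is lost. If it holds, so does the comparison for the column to the
    left of [i], the last one when [i = 0]: its top is not higher than the top
    of [i], and the bottom of [i] is level with the bottom of [i + 1]. *)
Lemma remove_column_winds_once P i Q : remove_column P i Q ->
  winds_once Q <-> winds_once P.
Proof.
move=> rem; have [WP hQ topQ bottomQ] := remove_column_spec rem.
case: rem; rewrite column_leafE => /andP[lt_i /eqP b_i] _ _.
have bottomS c : c < width Q -> bottom Q c.+1 = bottom P (bump i c).+1.
  move=> lt_c; rewrite bottomQ //; rewrite /bump.
  have [le_ic|lt_ci] := leqP i c; first by rewrite leqW.
  have [le_ic1|//] := leqP i c.+1.
  have Ei : c.+1 = i by lia.
  by rewrite /= add0n add1n Ei -b_i.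
split=> [[c lt_c]|[c lt_c le_c]].
  rewrite topQ // bottomS // hQ => le_c; exists (bump i c) => //.
  by rewrite WP /bump; lia.
have [c' [lt_c' neq_c'i le_c']] : exists c',
    [/\ c' < width P, c' != i & top P c' <= bottom P c'.+1 + height P].
  have [Ec|] := eqVneq c i; last by exists c.
  case: i {topQ bottomQ bottomS} lt_i b_i Ec => [|i] lt_i b_i Ec; last first.
    exists i; split; [by lia|by lia|]; rewrite b_i -Ec.
    by apply: leq_trans le_c; apply: top_homo; lia.
  exists (width P).-1; split; first by lia.
    apply: contraTneq (height_gt0 P) => W1.
    by rewrite -bottom_width (_ : width P = 1) -?b_i ?bottom0 //; lia.
  rewrite prednK // bottom_width top_last rowsE leq_add2r.
  apply: leq_trans (gluing_le_top P) _; move: le_c.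
  by rewrite Ec -b_i bottom0.
have E : bump i (unbump i c') = c' by apply: unbumpK; rewrite inE.
have lt_u : unbump i c' < width Q by rewrite /unbump; lia.
by exists (unbump i c') => //; rewrite topQ // bottomS // E hQ.
Qed.

(** The rows on which the new last column is glued are those above [height P]; its
    top may be lower than [rows P] when the last column of [P] is removed. *)
Lemma exists_remove_column P i : column_leaf P i -> exists Q, remove_column P i Q.
Proof.
move=> leaf; have := leaf; rewrite column_leafE => /andP[lt_i /eqP b_i].
have W_gt1 : 1 < width P.
  rewrite ltnNge; apply/negP=> W_le1; have := height_gt0 P; rewrite -bottom_width.
  have -> : width P = i.+1 by lia.
  by rewrite -b_i (_ : i = 0) ?bottom0 //; lia.
have lt_bump c : c < (width P).-1 -> bump i c < width P by rewrite /bump; lia.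
have bumpl c : c < i -> bump i c = c by rewrite /bump ltnNge => /negbTE->.
have bumpr c : i <= c -> bump i c = c.+1 by rewrite /bump => ->.
have lt_bt c : c < (width P).-1 -> bottom P (bump i c.+1) < top P (bump i c).
  move=> lt_c; have [lt_ic1|lt_ci|Ei] := ltngtP i c.+1.
  - by rewrite !bumpr //; [apply: bottom_lt_top; lia | apply: ltnW].
  - by rewrite !bumpl //; [apply: bottom_lt_top; lia | apply: ltnW].
  - rewrite -Ei bumpr // -b_i (bumpl c) Ei //.
    by apply: bottom_lt_top; lia.
have last_top : height P < top P (bump i (width P).-2).
  have := lt_bt (width P).-2; rewrite prednK; last by lia.
  rewrite bumpr; last by lia.
  by rewrite prednK ?bottom_width; [apply; lia | lia].
have := @exists_ppp (width P).-1 (height P)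
  (top P (bump i (width P).-2) - height P) (top P \o bump i) (bottom P \o bump i).
case=> //=.
- by lia.
- exact: height_gt0.
- by move=> c c' cc'; apply: top_homo; rewrite /bump; lia.
- by move=> c c' cc'; apply: bottom_homo; rewrite /bump; lia.
- case: (posnP i) => [i0|/bumpl->]; last exact: bottom0.
  by rewrite bumpr ?i0 //; move: b_i; rewrite i0 bottom0.
- by rewrite -(bottom_width P); congr bottom; rewrite /bump; lia.
- by rewrite subnK // ltnW.
- rewrite leq_subLR; apply: (@leq_trans (rows P)).
    by rewrite -top_last; apply: top_homo; have := lt_bump (width P).-2; lia.
  rewrite rowsE addnC leq_add2l; apply: leq_trans (gluing_le_top P) _.
  by apply: top_homo; have := lt_bump 0; lia.
move=> Q [WQ hQ gQ topQ bottomQ]; exists Q; split=> //.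
- move=> c j; rewrite !cellE WQ (_ : (c < _) = (bump i c < width P)); last first.
    by rewrite /bump; lia.
  case: ltnP => //= lt_c; rewrite topQ ?bottomQ //; move: lt_c; rewrite /bump; lia.
- by rewrite gQ rowsE gQ hQ; lia.
Qed.

(** * Removal of a leaf row *)

(** The new number of row [j] when the glued row [r], that is all the rows
    congruent to [r] modulo the height [h], is removed. *)
Definition survivors (h r j : nat) : nat :=
  count (fun k => k %% h != r) (iota 0 j).

Lemma survivorsS h r j : survivors h r j.+1 = survivors h r j + (j %% h != r).
Proof. by rewrite /survivors -addn1 iotaD count_cat /= addn0. Qed.

Lemma survivors_homo h r i j : i <= j -> survivors h r i <= survivors h r j.
Proof. by move=> /subnKC <-; rewrite /survivors iotaD count_cat leq_addr. Qed.

Lemma survivors_lt h r i j : j %% h != r -> i <= j ->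
  survivors h r i < survivors h r j.+1.
Proof.
by move=> j_r /(survivors_homo h r) le_ij; rewrite survivorsS j_r addn1 ltnS.
Qed.

Lemma survivors_period h r j :
  survivors h r (j + h) = survivors h r j + survivors h r h.
Proof.
rewrite addnC /survivors iotaD count_cat addnC; congr (_ + _).
rewrite add0n (_ : iota h j = [seq h + k | k <- iota 0 j]); last first.
  by rewrite -iotaDl addn0.
by rewrite count_map; apply: eq_count => k /=; rewrite modnDl.
Qed.

Lemma survivors_height h r : r < h -> survivors h r h = h.-1.
Proof.
move=> lt_r; suff E j : j <= h -> survivors h r j = j - (r < j).
  by rewrite E // lt_r subn1.
elim: j => [|j IH] lt_j //.
by rewrite survivorsS IH ?(ltnW lt_j) // modn_small //; lia.
Qed.

(** The new numbers start from 0, increase by one after each surviving row and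
    are unbounded, a row surviving in each period. *)
Lemma survivors_onto h r m : r < h -> 1 < h ->
  exists2 j, j %% h != r & survivors h r j = m.
Proof.
move=> lt_r h_gt1.
have ex : exists j, m < survivors h r j.
  exists (m.+1 * h); elim: m.+1 => // n IH.
  by rewrite mulSn addnC survivors_period survivors_height //; lia.
case: (ex_minnP ex) => -[//|j] lt_m min_j.
have : survivors h r j <= m by rewrite leqNgt; apply/negP=> /min_j; rewrite ltnn.
move: lt_m; rewrite survivorsS; case j_r : (j %% h != r) => /=; last by lia.
by exists j => //; lia.
Qed.

Lemma row_leaf_top P r c : row_leaf P r -> c < width P ->
  (top P c).-1 %% height P != r /\ (top P c).-1.+1 = top P c.
Proof.
rewrite row_leafE => /andP[_ /allP leaf] lt_c; split.
  by apply: leaf; rewrite mem_iota.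
by rewrite prednK //; have := bottom_lt_top lt_c; lia.
Qed.

Lemma row_leaf_height P r : row_leaf P r -> r < height P /\ 1 < height P.
Proof.
move=> leaf; have [top_r _] := row_leaf_top leaf (width_gt0 P).
move: leaf; rewrite row_leafE => /andP[lt_r _]; split=> //.
rewrite ltnNge; apply: contra top_r => h_le1.
by have := glued_row_lt P (top P 0).-1; rewrite /glued_row; lia.
Qed.

(** The row just under the top of a column survives, so the top stays above what
    was below it: every inequality between a top and another height, be it in
    the definition of a PPP or in [winds_once], is kept. *)
Lemma survivors_lt_top P r c x : row_leaf P r -> c < width P ->
  (survivors (height P) r x < survivors (height P) r (top P c)) = (x < top P c).
Proof.
move=> leaf lt_c; have [top_r <-] := row_leaf_top leaf lt_c.
have [le_x|gt_x] := ltnP x; first by rewrite survivors_lt.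
by apply/negbTE; rewrite -leqNgt; apply: survivors_homo.
Qed.

Lemma remove_row_spec P r Q : remove_row P r Q ->
  [/\ width Q = width P, height P = (height Q).+1,
      forall c, c < width P -> top Q c = survivors (height P) r (top P c) &
      forall c, c <= width P -> bottom Q c = survivors (height P) r (bottom P c)].
Proof.
case=> leaf cellQ gQ; have [lt_r h_gt1] := row_leaf_height leaf.
have := @ppp_of_cells Q (width P) (survivors (height P) r \o top P)
  (survivors (height P) r \o bottom P).
case=> /= [c lt_c|c m|WQ topQ bottomQ].
- rewrite survivors_lt_top //.
  by have := bottom_lt_top lt_c; have := @bottom_homo P c c.+1; lia.
- have [j j_r <-] := survivors_onto m lt_r h_gt1.
  rewrite cellQ // cellE; case: ltnP => //= lt_c; rewrite survivors_lt_top //.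
  congr (_ && _); have [le_b|gt_b] := leqP; first by rewrite survivors_homo.
  apply/esym/negbTE; rewrite -ltnNge.
  by apply: leq_trans (survivors_homo _ _ gt_b); rewrite survivorsS j_r addn1.
have hQ : height Q = (height P).-1 by have := gluing_gt0 Q; rewrite {1}/height; lia.
split=> //; first by rewrite hQ prednK // ltnW.
move=> c; rewrite leq_eqVlt => /predU1P[->|/bottomQ//].
by rewrite -{1}WQ !bottom_width hQ survivors_height.
Qed.

Lemma remove_row_winds_once P r Q : remove_row P r Q ->
  winds_once Q <-> winds_once P.
Proof.
move=> rem; have [WQ hP topQ bottomQ] := remove_row_spec rem.
case: rem => leaf _ _; have [lt_r _] := row_leaf_height leaf.
have hQ : height Q = survivors (height P) r (height P).
  by rewrite survivors_height // hP.
have E c : c < width P -> (top Q c <= bottom Q c.+1 + height Q) =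
    (top P c <= bottom P c.+1 + height P).
  move=> lt_c; rewrite topQ // bottomQ // hQ -survivors_period.
  by rewrite leqNgt survivors_lt_top // -leqNgt.
split=> -[c lt_c le_c]; exists c; move: lt_c le_c; rewrite ?WQ // => lt_c.
  by rewrite E.
by rewrite -E.
Qed.

Lemma exists_remove_row P r : row_leaf P r -> exists Q, remove_row P r Q.
Proof.
move=> leaf; have [lt_r h_gt1] := row_leaf_height leaf.
set sv := survivors (height P) r.
have svh : sv (height P) = (height P).-1 by apply: survivors_height.
have lt_bt c : c < width P -> sv (bottom P c.+1) < sv (top P c).
  by move=> lt_c; rewrite survivors_lt_top // bottom_lt_top.
have := @exists_ppp (width P) (height P).-1 (sv (gluing P))
  (sv \o top P) (sv \o bottom P).
case=> //=.
- exact: width_gt0.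
- by rewrite -ltnS prednK // ltnW.
- by move=> c c' cc'; apply: survivors_homo; apply: top_homo.
- by move=> c c' /andP[cc' _]; apply: survivors_homo; apply: bottom_homo.
- by rewrite bottom0.
- by rewrite bottom_width.
- by rewrite top_last rowsE /sv survivors_period -/sv svh.
- by apply: survivors_homo; apply: gluing_le_top.
move=> Q [WQ hQ gQ topQ bottomQ]; exists Q; split=> //; last by rewrite rowsE hQ; lia.
move=> c j; rewrite -/(sv j) /glued_row => j_r; rewrite !cellE WQ; case: ltnP => //= lt_c.
rewrite topQ // bottomQ ?(ltnW lt_c) // survivors_lt_top //; congr (_ && _).
have [le_b|gt_b] := leqP (bottom P c) j; first by rewrite survivors_homo.
apply/negbTE; rewrite -ltnNge; apply: leq_trans (survivors_homo _ _ gt_b).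
by rewrite survivorsS j_r addn1.
Qed.

Lemma leaf_removal_winds_once P Q : leaf_removal P Q -> winds_once Q <-> winds_once P.
Proof.
case=> -[x]; first exact: remove_column_winds_once.
exact: remove_row_winds_once.
Qed.

(** * PPP's without leaves are trunks *)

Definition leafless P :=
  (forall i, ~~ column_leaf P i) /\ (forall r, ~~ row_leaf P r).

Lemma exists_leaf_removal P : ~ leafless P ->
  exists2 Q, leaf_removal P Q & semiperimeter Q < semiperimeter P.
Proof.
move=> leafy; have [[i leaf]|no_col] := pselect (exists i, column_leaf P i).
  have [Q rem] := exists_remove_column leaf; exists Q; first by left; exists i.
  have [WP hQ _ _] := remove_column_spec rem.
  by rewrite /semiperimeter; lia.
have [[r leaf]|no_row] := pselect (exists r, row_leaf P r); last first.
  case: leafy; split=> x; apply/negP=> leaf.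
    by apply: no_col; exists x.
  by apply: no_row; exists x.
have [Q rem] := exists_remove_row leaf; exists Q; first by right; exists r.
have [WP hQ _ _] := remove_row_spec rem.
by rewrite /semiperimeter; lia.
Qed.

(** Without leaf column, the lower boundary rises at each column. *)
Lemma bottom_slope P i j : (forall i, ~~ column_leaf P i) ->
  i <= j <= width P -> bottom P i + (j - i) <= bottom P j.
Proof.
move=> no_leaf /andP[/subnKC <-]; rewrite addKn; elim: (j - i) => [|n IH].
  by rewrite !addn0.
rewrite addnS => lt_j; apply: (@leq_trans (bottom P (i + n)).+1).
  by rewrite addnS ltnS IH // ltnW.
have := no_leaf (i + n); have := @bottom_homo P _ _ (leqnSn (i + n)).
by rewrite column_leafE lt_j /=; lia.
Qed.

Lemma width_le_height P : (forall i, ~~ column_leaf P i) -> width P <= height P.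
Proof.
move=> /bottom_slope/(_ (leqnn (width P) : 0 <= _ <= _)).
by rewrite bottom0 bottom_width subn0.
Qed.

(** Without leaf row the tops of the columns meet every glued row; without leaf
    column there are not more columns than rows, so each row is met once. *)
Lemma leafless_tops P (tops := [seq glued_row P (top P c).-1 | c <- iota 0 (width P)]) :
  leafless P -> [/\ width P = height P, uniq tops & tops =i iota 0 (height P)].
Proof.
move=> [/width_le_height le_Wh no_row].
have sub : {subset iota 0 (height P) <= tops}.
  move=> r; rewrite mem_iota /= => lt_r; have := no_row r.
  rewrite row_leafE lt_r /= => /allPn[c c_W]; rewrite negbK => /eqP<-.
  exact: map_f.
have szW : size tops = width P by rewrite size_map size_iota.
have Utops : uniq tops.
  by apply: leq_size_uniq sub _; rewrite ?iota_uniq // szW size_iota.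
have [|Esz Emem] := uniq_min_size (iota_uniq 0 (height P)) sub.
  by rewrite szW size_iota.
by split=> [|//|r]; rewrite ?Emem // -szW -Esz size_iota.
Qed.

Lemma parent_column P c : parent P (column_vertex P c) =
  row_vertex P (glued_row P (top P c).-1).
Proof. by rewrite /parent eqxx. Qed.

Lemma parent_row P j c : c < width P -> bottom P c <= j < bottom P c.+1 ->
  parent P (row_vertex P j) = column_vertex P c.
Proof.
move=> lt_c c_j; rewrite (row_vertexE lt_c c_j) /parent.
case: eqP => // -[Ej]; have := bottom_lt_top lt_c; rewrite /top; lia.
Qed.

Variant vertex_spec P (v : nat * nat) : Prop :=
| ColumnVertex c of c < width P & v = column_vertex P c
| RowVertex j c of j < height P & c < width P & bottom P c <= j < bottom P c.+1
    & v = row_vertex P j.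

Lemma verticesP P v : reflect (vertex_spec P v) (v \in vertices P).
Proof.
rewrite mem_cat; apply: (iffP orP) => [[/mapP[c]|/mapP[j]]|[c lt_c ->|j c lt_j _ _ ->]].
- by rewrite mem_iota => lt_c ->; apply: ColumnVertex lt_c _.
- rewrite mem_iota => lt_j ->; have [c lt_c c_j] := row_endP lt_j.
  exact: RowVertex lt_j lt_c c_j _.
- by left; apply: map_f; rewrite mem_iota.
- by right; apply: map_f; rewrite mem_iota.
Qed.

Lemma parent_vertices P : {in vertices P, forall v, parent P v \in vertices P}.
Proof.
move=> v /verticesP[c lt_c ->|j c _ lt_c c_j ->].
  rewrite parent_column mem_cat orbC map_f // mem_iota.
  exact: glued_row_lt.
by rewrite (parent_row lt_c) // mem_cat map_f // mem_iota.
Qed.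

(** A map from a finite set onto itself is a permutation of it, and its orbits
    are cycles. *)
Lemma fcycle_of_onto (T : choiceType) (s : seq T) (f : T -> T) :
    {in s, forall x, f x \in s} ->
    {in s, forall y, exists2 x, x \in s & f x = y} ->
  {in s, forall x, exists2 c, fcycle f c & x \in c}.
Proof.
move=> fs onto x xs.
pose g (y : seq_sub s) : seq_sub s := SeqSub (fs _ (ssvalP y)).
have g_onto y : y \in codom g.
  have [z zs Ez] := onto _ (ssvalP y).
  by apply/codomP; exists (SeqSub zs); apply: val_inj; rewrite /= Ez.
have g_inj : injective g.
  have /image_injP inj_g : #|codom g| == #|{: seq_sub s}|.
    by apply/eqP; apply: eq_card => y; rewrite g_onto.
  by move=> y z; apply: inj_g.
exists [seq val y | y <- orbit g (SeqSub xs)].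
  have := cycle_orbit g_inj (SeqSub xs); apply: homo_cycle => y z /eqP <- /=.
  by rewrite eqxx.
by apply/mapP; exists (SeqSub xs); rewrite ?in_orbit.
Qed.

(** The predecessor is found inside [s] because the whole cycle is reached from
    [v], which is in [s]. *)
Lemma fcycle_predecessor (T : eqType) (s c : seq T) (f : T -> T) v :
    {in s, forall x, f x \in s} -> v \in s -> fcycle f c -> v \in c ->
  exists2 w, w \in s & f w = v.
Proof.
move=> fs vs f_c /rot_to[i c' Ec]; move: f_c; rewrite -(rot_cycle i) Ec /=.
rewrite rcons_path => /andP[f_c' /eqP Ef]; exists (last v c') => // {Ef}.
elim: c' v vs f_c' {Ec} => //= y c' IH v vs /andP[/eqP<- f_c'].
by apply: IH f_c' => //; apply: fs.
Qed.

Lemma leafless_is_trunk P : leafless P -> is_trunk P.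
Proof.
move=> P_leafless; have [no_col no_row] := P_leafless.
apply: fcycle_of_onto; first exact: parent_vertices.
move=> v /verticesP[c lt_c ->|r c lt_r _ _ ->].
  exists (row_vertex P (bottom P c)).
    rewrite mem_cat orbC map_f // mem_iota /=.
    by have := bottom_slope no_col (i := c) (j := width P); rewrite bottom_width; lia.
  apply: parent_row => //; rewrite leqnn /=.
  by have := bottom_slope no_col (i := c) (j := c.+1); lia.
have [_ _ topsE] := leafless_tops P_leafless.
have : r \in iota 0 (height P) by rewrite mem_iota.
rewrite -topsE => /mapP[c' c'_W Er]; exists (column_vertex P c').
  by rewrite mem_cat map_f.
by rewrite parent_column -Er.
Qed.

(** On a cycle, a column is the parent of something, and only a row that ends in
    this column can be its child. *)
Lemma is_trunk_no_column_leaf P : is_trunk P -> forall i, ~~ column_leaf P i.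
Proof.
move=> trunkP i; rewrite column_leafE; case: (ltnP i) => //= lt_i.
have i_vs : column_vertex P i \in vertices P.
  by apply/verticesP; apply: ColumnVertex lt_i _.
have [c f_c i_c] := trunkP _ i_vs.
have [w /verticesP[c' lt_c' ->|j c' _ lt_c' c'_j ->]] :=
  fcycle_predecessor (@parent_vertices P) i_vs f_c i_c.
  rewrite parent_column; set j := glued_row _ _.
  have [c2 lt_c2 c2_j] := row_endP (glued_row_lt P (top P c').-1 : j < _).
  rewrite (row_vertexE lt_c2 c2_j) => -[Ec Ej].
  by have := bottom_lt_top lt_i; rewrite -Ec -/(top P c2) in Ej *; lia.
by rewrite (parent_row lt_c' c'_j) => -[<-]; lia.
Qed.

(** The tops of a leafless PPP lie in distinct rows of the cylinder, so they
    increase strictly from column to column, also across the gluing, and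
    [top P c = gluing P + c + 1], while [bottom P c = c]. *)
Lemma leafless_gluing P : leafless P -> winds_once P -> gluing P <= width P.
Proof.
move=> P_leafless [c lt_c]; have [Wh U_tops _] := leafless_tops P_leafless.
have top_inj i j : i < width P -> j < width P ->
    glued_row P (top P i).-1 = glued_row P (top P j).-1 -> i = j.
  move=> lt_i lt_j E; apply/eqP.
  rewrite -(nth_uniq 0 _ _ U_tops) ?size_map ?size_iota //.
  by rewrite !(nth_map 0) ?size_iota // !nth_iota // E.
have top0 : gluing P < top P 0.
  rewrite ltn_neqAle gluing_le_top andbT; apply/eqP=> E0.
  have W1 : 0 = (width P).-1.
    apply: top_inj; rewrite ?width_gt0 ?prednK ?width_gt0 // top_last rowsE -E0.
    have := gluing_gt0 P; case: (gluing P) => // g _.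
    by rewrite /glued_row addSn /= modnDr.
  have := top_last P; rewrite -W1 -E0 rowsE; have := height_gt0 P; lia.
have le_top i : i < width P -> gluing P + i < top P i.
  elim: i => [|i IH] lt_i; first by rewrite addn0.
  have := IH (ltnW lt_i); have : top P i != top P i.+1.
    by apply/eqP=> E; have := top_inj i i.+1; rewrite E; lia.
  by have := @top_homo P i i.+1; rewrite leqnSn lt_i => /(_ isT); lia.
have := bottom_slope P_leafless.1 (i := 0) (j := c.+1).
have := bottom_slope P_leafless.1 (i := c.+1) (j := width P).
rewrite bottom_width -Wh; have := le_top c lt_c; lia.
Qed.

(** The property on the right is kept by the removals of leaves in both
    directions. On a trunk the width is the height, and [winds_once] amounts to
    [gluing T <= width T]. *)
Lemma primitiveE P : primitive P <-> winds_once P.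
Proof.
split=> [[T [rem trunkT] le_g]|].
  have : winds_once T.
    exists (width T).-1; rewrite ?prednK ?width_gt0 //.
    rewrite top_last rowsE bottom_width leq_add2r; apply: leq_trans le_g _.
    exact/width_le_height/is_trunk_no_column_leaf.
  elim: rem {trunkT le_g} => // [Q R /leaf_removal_winds_once[] //|Q R S _ IH1 _ IH2].
  by move=> /IH2.
have [n le_n] := ubnP (semiperimeter P); elim: n P le_n => // n IH P le_n windP.
have [leafP|leafyP] := pselect (leafless P).
  exists P; last exact: leafless_gluing.
  by split; [apply: rt_refl | apply: leafless_is_trunk].
have [Q remQ lt_Q] := exists_leaf_removal leafyP.
have [||T [remT trunkT] le_g] := IH Q; first exact: leq_trans lt_Q _.
  exact/(leaf_removal_winds_once remQ).
exists T => //; split=> //.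
by apply: rt_trans remT; apply: rt_step.
Qed.

(** * PPP's as pairs of words *)

(** The PPP's as pairs of words: the upper path of a PPP starts with [g] North
    steps and ends with an East step, and its lower path starts with an East
    step and ends with [g] North steps. *)
Definition words_ppp (p q : lpath) (g : nat) : lpath * lpath * nat :=
  (nseq g true ++ rcons p false, false :: q ++ nseq g true, g).

Lemma east_height_nseq_cat g p i : i < easts p ->
  east_height (nseq g true ++ p) i = g + east_height p i.
Proof.
move=> lt_i; elim: g => //= g IH.
by rewrite east_height_north ?IH // easts_cat easts_nseq.
Qed.

Lemma east_height_cat p q i : i < easts p ->
  east_height (p ++ q) i = east_height p i.
Proof.
by move=> lt_i; rewrite /east_height east_heights_from_cat nth_cat
  size_east_heights_from lt_i.
Qed.

Lemma easts_rcons_east p : easts (rcons p false) = (easts p).+1.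
Proof. by rewrite -cats1 easts_cat addn1. Qed.

Lemma norths_rcons_east p : norths (rcons p false) = norths p.
Proof. by rewrite -cats1 norths_cat addn0. Qed.

Lemma east_height_rcons_last p : east_height (rcons p false) (easts p) = norths p.
Proof.
rewrite /east_height -cats1 east_heights_from_cat nth_cat.
by rewrite size_east_heights_from ltnn subnn.
Qed.

(** With the upper boundary moved down by the gluing size, so that it starts at
    height 0 like the lower one, this is the largest excess of the bottom of a
    column over the top of the column on its left: the boundaries of the PPP are
    disjoint exactly when the gluing size is larger. *)
Definition overlap (p q : lpath) : nat :=
  \max_(i < (easts p).+1)
     (east_height (rcons q false) i - east_height (rcons p false) i).

Lemma easts_eq p q : size p = size q -> norths p = norths q -> easts p = easts q.
Proof. by have := northsDeasts p; have := northsDeasts q; lia. Qed.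

Lemma words_is_ppp p q g : size p = size q -> norths p = norths q ->
  0 < norths p -> overlap p q < g -> is_ppp (words_ppp p q g).
Proof.
move=> sz_pq nn_pq n_gt0 lt_g; have ee_pq := easts_eq sz_pq nn_pq.
have eu : easts (nseq g true ++ rcons p false) = (easts p).+1.
  by rewrite easts_cat easts_nseq easts_rcons_east.
have nu : norths (nseq g true ++ rcons p false) = g + norths p.
  by rewrite norths_cat norths_nseq norths_rcons_east mul1n.
have top_u i : i <= easts p -> east_height (nseq g true ++ rcons p false) i =
    g + east_height (rcons p false) i.
  by move=> le_i; rewrite east_height_nseq_cat // easts_rcons_east.
apply/is_pppP; rewrite ?eu ?nu.
- by rewrite /= !size_cat size_rcons !size_nseq; lia.
- by rewrite /= norths_cat norths_nseq nn_pq mul1n addnC.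
split=> //.
- by split=> //; rewrite top_u // east_height_rcons_last.
- move=> i lt_i; rewrite top_u; last by lia.
  rewrite east_height_east east_height_cat -?ee_pq //.
  have lt_i1 : i < (easts p).+1 by lia.
  have := @leq_bigmax _ (fun i : 'I_(easts p).+1 => east_height (rcons q false) i -
    east_height (rcons p false) i) (Ordinal lt_i1).
  by rewrite -/(overlap p q) /= -{1}cats1 east_height_cat -?ee_pq //; lia.
- by lia.
- rewrite top_u // leq_addr addnC leq_add2l; split=> //.
  rewrite east_height_east /=; case E: (easts p) => [|e] //.
  by rewrite east_height_cat -?ee_pq ?E // nn_pq east_height_le_norths.
Qed.

Section WordsOfPpp.
Variables (P : ppp) (p q : lpath) (g : nat).
Hypotheses (P_words : ppp_val P = words_ppp p q g).
Hypotheses (sz_pq : size p = size q) (nn_pq : norths p = norths q).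

Lemma words_gluing : gluing P = g.
Proof. by rewrite /gluing P_words. Qed.

Lemma words_width : width P = (easts p).+1.
Proof.
by rewrite /width /upper P_words /= easts_cat easts_nseq easts_rcons_east.
Qed.

Lemma words_height : height P = norths p.
Proof.
rewrite /height /rows words_gluing /upper P_words /=.
by rewrite norths_cat norths_nseq norths_rcons_east mul1n addKn.
Qed.

Lemma words_semiperimeter : semiperimeter P = (size p).+1.
Proof.
by rewrite /semiperimeter words_height words_width addnS northsDeasts.
Qed.

Lemma words_top i : i <= easts p -> top P i = g + east_height (rcons p false) i.
Proof.
move=> le_i; rewrite /top /upper P_words /=.
by rewrite east_height_nseq_cat // easts_rcons_east.
Qed.

Lemma words_bottom i : i <= easts p -> bottom P i.+1 = east_height (rcons q false) i.
Proof.
have ee_pq := easts_eq sz_pq nn_pq; rewrite leq_eqVlt => /predU1P[->|lt_i].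
  rewrite -words_width bottom_width words_height ee_pq.
  by rewrite east_height_rcons_last.
rewrite /bottom words_width ltnS lt_i /lower P_words /= east_height_east.
by rewrite -cats1 !east_height_cat -?ee_pq.
Qed.

Lemma words_overlap : overlap p q < g.
Proof.
rewrite -[g]prednK -?words_gluing ?gluing_gt0 // words_gluing ltnS.
apply/bigmax_leqP=> -[i /=]; rewrite ltnS => le_i _.
have := @bottom_lt_top P i; rewrite words_width words_top // words_bottom //; lia.
Qed.

Lemma words_winds_once : winds_once P <-> g <= overlap p q + norths p.
Proof.
split=> [[i]|le_g].
  rewrite words_width ltnS => le_i; rewrite words_top // words_bottom // words_height.
  have := @leq_bigmax _ (fun i : 'I_(easts p).+1 => east_height (rcons q false) i -
    east_height (rcons p false) i) (Ordinal (le_i : i < (easts p).+1)).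
  by rewrite -/(overlap p q) /=; lia.
have [O0|O_gt0] := posnP (overlap p q).
  exists (easts p); rewrite ?words_width // words_top // words_bottom // words_height.
  by rewrite east_height_rcons_last (easts_eq sz_pq nn_pq) east_height_rcons_last; lia.
have [|[i lt_i] Ei] := eq_bigmax (fun i : 'I_(easts p).+1 =>
  east_height (rcons q false) i - east_height (rcons p false) i).
  by rewrite card_ord.
exists i; rewrite ?words_width // words_top // words_bottom // words_height.
by move: Ei le_g O_gt0; rewrite -/(overlap p q) => -> /=; lia.
Qed.

End WordsOfPpp.

Lemma ppp_words P : exists p q, [/\ ppp_val P = words_ppp p q (gluing P),
  size p = size q & norths p = norths q].
Proof.
have [W_gt0 [d0 uW] _ _ [/north_prefix[u' Eu] le_gW]] := ppp_path_spec P.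
have [sz nn] := path_norths_easts P.
have [||d' Ed] := @north_suffix (gluing P) (lower P); rewrite ?easts_lower //.
  by rewrite -nn.
have g_gt0 := gluing_gt0 P.
have [p Ep] : exists p, u' = rcons p false.
  have W_u' : easts u' = width P by rewrite /width Eu easts_cat easts_nseq.
  case/lastP: u' => [|p []] in Eu W_u' *; last by exists p.
    by move: W_gt0; rewrite -W_u'.
  have lt_pW : (width P).-1 < easts (nseq (gluing P) true ++ p).
    rewrite easts_cat easts_nseq (_ : easts p = width P) ?prednK //.
    by rewrite -W_u' -cats1 easts_cat addn0.
  move: uW; rewrite /top /rows Eu -cats1 catA east_height_cat // norths_cat /=.
  by have := east_height_le_norths (nseq (gluing P) true ++ p) (width P).-1; lia.
have [q Eq] : exists q, d' = false :: q.
  have W_d : 0 < easts (lower P) by rewrite easts_lower.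
  case: d' => [|[] q] in Ed *; last by exists q.
    by move: W_d; rewrite Ed easts_nseq.
  by move: d0 W_d; rewrite Ed => /[swap] W_d; rewrite east_height_north.
exists p, q; rewrite /words_ppp -cat_cons -Eq -Ep.
rewrite -Ed -Eu; split.
- by rewrite /upper /lower /gluing; case: (ppp_val P) => -[].
- move: sz; rewrite Eu Ed Ep Eq !size_cat size_rcons /= size_nseq; lia.
- move: nn; rewrite Eu Ed Ep Eq !norths_cat norths_rcons_east /=; lia.
Qed.

(** * The number of primitive PPP's *)

Definition north_words N h := [set p : N.-tuple bool | norths p == h]%SET.

Lemma card_north_words N h : #|north_words N h| = 'C(N, h).
Proof.
pose f (A : {set 'I_N}) := [tuple i \in A | i < N].
have f_bij : bijective f.
  exists (fun p : N.-tuple bool => [set i | tnth p i]%SET) => [A|p].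
    by apply/setP=> i; rewrite inE tnth_mktuple.
  by apply: eq_from_tnth => i; rewrite tnth_mktuple inE.
rewrite -[in RHS](card_ord N) -card_draws -(on_card_preimset (onW_bij _ f_bij)).
apply: eq_card => A; rewrite !inE; congr (_ == h).
by rewrite /norths /f /= count_map enumT cardE /enum_mem size_filter.
Qed.

(** A primitive PPP amounts to two words with equally many North steps, the
    height, and one of the [height] admissible values of the gluing size. *)
Definition word_pairs N :=
  [set x : N.-tuple bool * N.-tuple bool * 'I_N |
     (norths x.1.1 == norths x.1.2) && (x.2 < norths x.1.1)]%SET.

Lemma sum_north_words N (F : nat -> nat) :
  \sum_(p : N.-tuple bool) F (norths p) = \sum_(h < N.+1) 'C(N, h) * F h.
Proof.
have norths_lt (p : N.-tuple bool) : norths p < N.+1.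
  by rewrite ltnS -[X in _ <= X](size_tuple p) count_size.
rewrite (partition_big (fun p => Ordinal (norths_lt p)) xpredT) //=.
apply: eq_bigr => h _; rewrite -card_north_words -sum_nat_const.
by apply: eq_big => [p|p /eqP <-//]; rewrite inE.
Qed.

Lemma card_word_pairs n : #|word_pairs n.+1| = n.+1 * 'C(2 * n + 1, n).
Proof.
have -> : #|word_pairs n.+1| =
    \sum_(p : n.+1.-tuple bool) \sum_(q : n.+1.-tuple bool | norths p == norths q)
      \sum_(r < n.+1 | r < norths p) 1.
  rewrite (pair_big_dep xpredT (fun p q : n.+1.-tuple bool => norths p == norths q)
    (fun p q => \sum_(r < n.+1 | r < norths p) 1)) /=.
  by rewrite (pair_big_dep (fun pq : n.+1.-tuple bool * n.+1.-tuple bool =>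
    norths pq.1 == norths pq.2) (fun pq (r : 'I_n.+1) => r < norths pq.1)
    (fun _ _ => 1)) sum1_card; apply: eq_card => x; rewrite inE.
rewrite (eq_bigr (fun p : n.+1.-tuple bool =>
  'C(n.+1, norths p) * norths p)) => [|p _]; last first.
  have -> : \sum_(r < n.+1 | r < norths p) 1 = norths p.
    have le_p : norths p <= n.+1.
      by rewrite -[X in _ <= X](size_tuple p) count_size.
    by rewrite -(big_ord_widen _ (fun _ => 1)) // sum1_card card_ord.
  rewrite sum_nat_const -card_north_words; congr (_ * _).
  by apply: eq_card => q; rewrite !inE eq_sym.
rewrite (sum_north_words n.+1 (fun h => 'C(n.+1, h) * h)) big_ord_recl !muln0 add0n.
have -> : 2 * n + 1 = n + n.+1 by lia.
rewrite -binomial.Vandermonde big_distrr /=; apply: eq_bigr => j _.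
move: (nat_of_ord j) (ltn_ord j) => {}j lt_j; rewrite /bump /= add1n.
rewrite -(@bin_sub n.+1 (n - j)); last by lia.
have -> : n.+1 - (n - j) = j.+1 by lia.
by rewrite [_ * j.+1]mulnC -mul_bin_diag mulnCA [_ * 'C(_.-1, _)]mulnC.
Qed.

(** A default value, outside the words that give a PPP. *)
Definition smallest_ppp : ppp := @PPP (words_ppp [:: true] [:: true] 1) isT.

Definition ppp_of_words N (x : N.-tuple bool * N.-tuple bool * 'I_N) : ppp :=
  insubd smallest_ppp (words_ppp x.1.1 x.1.2 (overlap x.1.1 x.1.2 + x.2).+1).

Lemma ppp_of_wordsK N (x : N.-tuple bool * N.-tuple bool * 'I_N) :
  x \in word_pairs N -> ppp_val (ppp_of_words x) =
    words_ppp x.1.1 x.1.2 (overlap x.1.1 x.1.2 + x.2).+1.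
Proof.
case: x => [[p q] r]; rewrite inE /= => /andP[/eqP nn_pq lt_r].
apply: insubdK; apply: words_is_ppp; rewrite ?size_tuple //.
  exact: leq_ltn_trans lt_r.
by rewrite ltnS leq_addr.
Qed.

Lemma ppp_of_words_inj N : {in word_pairs N &, injective (@ppp_of_words N)}.
Proof.
move=> [[p q] r] [[p' q'] r'] /ppp_of_wordsK Ex /ppp_of_wordsK Ex' E.
move: Ex'; rewrite -E Ex => -[/eqP Eu /eqP Ed Eg].
move: Eu Ed; rewrite Eg eqseq_cat // eqxx /= -!cats1 eqseq_cat ?size_tuple //.
rewrite eqseq_cat ?size_tuple // !eqxx !andbT => /eqP/val_inj Ep /eqP/val_inj Eq.
by move: Eg; rewrite Ep Eq => /addnI/val_inj->.
Qed.

(** Given the words, the boundaries are disjoint when [g] is larger than the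
    overlap, and the PPP winds once when [g] exceeds the overlap by at most the
    height: the third component of a [word_pairs] is the position of [g] in this
    interval. *)
Lemma primitive_ppps_ofE N : primitive_ppps_of N.+1 =
  [set` [fset ppp_of_words x | x in word_pairs N]%fset]%classic.
Proof.
apply/seteqP; split=> P; last first.
  move=> /imfsetP[[[p q] r] x_pairs ->]; have valP := ppp_of_wordsK x_pairs.
  move: x_pairs; rewrite inE /= => /andP[/eqP nn_pq lt_r].
  have sz_pq : size p = size q by rewrite !size_tuple.
  split; last by rewrite (words_semiperimeter valP) size_tuple.
  by apply/primitiveE/(words_winds_once valP) => //=; lia.
case=> /primitiveE windP; have [p [q [valP sz_pq nn_pq]]] := ppp_words P.
rewrite (words_semiperimeter valP) => -[szp].
have szq : size q = N by rewrite -sz_pq.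
move/(words_winds_once valP sz_pq nn_pq): windP => le_g.
have lt_g := words_overlap valP sz_pq nn_pq.
have le_N : norths p <= N by rewrite -szp count_size.
have lt_r : gluing P - (overlap p q).+1 < N by lia.
pose x := (Tuple (introT eqP szp), Tuple (introT eqP szq), Ordinal lt_r).
have x_pairs : x \in word_pairs N by rewrite inE /= nn_pq eqxx /=; lia.
apply/imfsetP; exists x => //=.
apply: val_inj; rewrite [LHS]valP -[RHS]/(ppp_val _) (ppp_of_wordsK x_pairs) /=.
by congr words_ppp; lia.
Qed.

Lemma finite_primitive_ppps_of s : finite_set (primitive_ppps_of s).
Proof.
case: s => [|N]; last by rewrite primitive_ppps_ofE; apply: finite_fset.
rewrite (_ : primitive_ppps_of 0 = set0) //.
apply/seteqP; split=> // P [_]; have := width_gt0 P.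
by rewrite /semiperimeter; lia.
Qed.

Lemma card_primitive_ppps_of n :
  #|` fset_set (primitive_ppps_of n.+2)|%fset = n.+1 * 'C(2 * n + 1, n).
Proof.
rewrite primitive_ppps_ofE set_fsetK card_in_imfset; last exact: ppp_of_words_inj.
by rewrite -card_word_pairs cardE.
Qed.

Lemma card_primitive_ppps_of_le1 s : s <= 1 ->
  #|` fset_set (primitive_ppps_of s)|%fset = 0.
Proof.
move=> le_s1; rewrite (_ : primitive_ppps_of s = set0) ?fset_set0 ?cardfs0 //.
apply/seteqP; split=> // P [_]; have := width_gt0 P; have := height_gt0 P.
by rewrite /semiperimeter; lia.
Qed.

(** * The generating series *)

Import GRing.Theory Num.Theory.
Local Open Scope ring_scope.

Lemma fps_exp_scale c k m :
  fps_exp (fps_scale c fps_z) k m = c ^+ k * (m == k)%:R.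
Proof.
elim: k m => [|k IH] m; first by rewrite mul1r.
rewrite /fps_exp iterS -/(fps_exp _ k) /fps_mul /fps_scale.
case: m => [|m]; first by rewrite big_ord1 /fps_z !mulr0 mul0r.
rewrite !big_ord_recl big1 => [|i _]; last by rewrite /fps_z /= mulr0 mul0r.
by rewrite /fps_z /= mulr0 mul0r add0r addr0 mulr1 subSS subn0 IH exprS mulrA.
Qed.

Lemma fps_exp_z k m : fps_exp fps_z k m = (m == k)%:R.
Proof.
have <- : fps_scale 1 fps_z = fps_z by apply/funext => i; rewrite /fps_scale mul1r.
by rewrite fps_exp_scale expr1n mul1r.
Qed.

Lemma coef_1Dpow_scale_z c alpha m :
  fps_1Dpow (fps_scale c fps_z) alpha m = gbinom alpha m * c ^+ m.
Proof.
rewrite /fps_1Dpow big_ord_recr big1 /= => [|i _].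
  by rewrite fps_exp_scale eqxx mulr1 add0r.
by rewrite fps_exp_scale gtn_eqF // !mulr0.
Qed.

Lemma fps_z_mul k a m :
  fps_mul (fps_exp fps_z k) a m = if (k <= m)%N then a (m - k)%N else 0.
Proof.
rewrite /fps_mul; case: leqP => [le_k|lt_m]; last first.
  rewrite big1 // => i _; rewrite fps_exp_z (_ : _ == k = false) ?mul0r //.
  by apply/ltn_eqF; apply: leq_trans lt_m.
rewrite (bigD1 (Ordinal (le_k : (k < m.+1)%N))) //= fps_exp_z eqxx mul1r.
rewrite big1 ?addr0 // => i; rewrite -val_eqE /= fps_exp_z => /negbTE->.
by rewrite mul0r.
Qed.

(** Both sides are multiplied by [(4n + 6) / (n + 1)] when [n] becomes [n + 1]. *)
Lemma gbinom_m3half n : gbinom (- (3%:R / 2%:R)) n * (- 4%:R) ^+ n =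
  ((2 * n).+1)`!%:R / (n`! ^ 2)%N%:R.
Proof.
elim: n => [|n IH]; first by rewrite /gbinom big_ord0 expr0 mulr1.
have gS : gbinom (- (3%:R / 2%:R)) n.+1 =
    gbinom (- (3%:R / 2%:R)) n * ((- (3%:R / 2%:R) - n%:R) / n.+1%:R).
  rewrite /gbinom big_ord_recr factS natrM /= invfM; ring.
rewrite gS exprSr mulrACA IH mulnS !addSn add0n !factS !natrM.
have n1_neq0 : n.+1%:R != 0 :> rat by rewrite pnatr_eq0.
have nf_neq0 : n`!%:R != 0 :> rat by rewrite pnatr_eq0 -lt0n fact_gt0.
by field; rewrite nf_neq0 -natr1 addrC in n1_neq0 *.
Qed.

Lemma primitive_count n :
  (n.+1 * 'C(2 * n + 1, n))%N%:R = ((2 * n).+1)`!%:R / (n`! ^ 2)%N%:R :> rat.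
Proof.
have le_n : (n <= 2 * n + 1)%N by lia.
have := bin_fact le_n; rewrite (_ : 2 * n + 1 - n = n.+1)%N; last by lia.
rewrite addn1 => <-; rewrite factS !natrM.
have nf_neq0 : n`!%:R != 0 :> rat by rewrite pnatr_eq0 -lt0n fact_gt0.
by field.
Qed.

Lemma coef_primitive_series s :
  primitive_series s = #|` fset_set (primitive_ppps_of s)|%fset%:R.
Proof.
rewrite /primitive_series -(fsbig_widen (primitive_ppps_of s)).
- rewrite (eq_fsbigr (fun=> 1)) => [|P]; last first.
    by rewrite inE => -[_ <-]; rewrite fps_exp_z eqxx.
  rewrite fsbig_finite; last exact: finite_primitive_ppps_of.
  by rewrite big_const_seq count_predT iter_addr_0.
- by move=> P [].
- move=> P [primP not_s] /=; rewrite fps_exp_z; case: eqP => // Es.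
  by case: not_s.
Qed.

Theorem theorem4p5 :
  (forall s : nat, finite_set (primitive_ppps_of s)) /\
  (forall n : nat,
     (#|` fset_set (primitive_ppps_of n.+2)|)%fset%:R =
     ((2 * n).+1)`!%:R / (n`! ^ 2)%N%:R :> rat) /\
  (primitive_series =1
     fps_mul (fps_exp fps_z 2) (fps_1Dpow (fps_scale (- 4%:R) fps_z) (- (3%:R / 2%:R)))).
Proof.
split; first exact: finite_primitive_ppps_of.
split=> [n|s]; first by rewrite card_primitive_ppps_of primitive_count.
rewrite coef_primitive_series fps_z_mul; case: s => [|[|n]] /=.
- by rewrite card_primitive_ppps_of_le1.
- by rewrite card_primitive_ppps_of_le1.
- rewrite card_primitive_ppps_of primitive_count subn2.
  by rewrite coef_1Dpow_scale_z gbinom_m3half.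
Qed.
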